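(* Let $G\in\mathcal{F}$ have $n$ vertices. If $G$ is not isomorphic to any of the four graphs $\overline{F}_0,\overline{F}_1,\overline{F}_2,\overline{F}_3$ described below, then $\mathrm{mms}(G)\ge n/2-1$. Here: $\overline{F}_0=K_{3,3}$; $\overline{F}_1$ is obtained from two disjoint copies of $K_{2,3}$ by adding a perfect matching between the three degree-$2$ vertices of the first copy and the three degree-$2$ vertices of the second copy ($10$ vertices); $\overline{F}_2$ is obtained from a star $K_{1,3}$ with center $d$ and leaves $c_1,c_2,c_3$ and two disjoint copies of $K_{2,3}$ whose degree-$2$ vertices are $x_1,x_2,x_3$ and $y_1,y_2,y_3$ respectively, by adding the edges $c_ix_i$ and $c_iy_i$ for $i=1,2,3$ ($14$ vertices); $\overline{F}_3$ is obtained from three disjoint copies of $K_{2,3}$, whose degree-$2$ vertices are $a_1,a_2,a_3$, $b_1,b_2,b_3$ and $c_1,c_2,c_3$ respectively, and three new vertices $z_1,z_2,z_3$, by adding the edges $z_ia_i$, $z_ib_i$, $z_ic_i$ for $i=1,2,3$ ($18$ vertices).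
   Context: All graphs are finite and simple. A matching $M$ of $G$ is separating if $G-M$ has more connected components than $G$; $\mathrm{mms}(G)$ denotes the maximum size of a separating matching of $G$ ($0$ if none exists). Star product: given cubic graphs $G_1,G_2$ and vertices $u\in V(G_1)$, $v\in V(G_2)$, a star product $(G_1,u)*(G_2,v)$ is any graph obtained from the disjoint union of $G_1$ and $G_2$ by deleting $u$ and $v$ and joining the three neighbours of $u$ in $G_1$ to the three neighbours of $v$ in $G_2$ by a perfect matching (of size three, chosen arbitrarily). Let $H_0$ denote the Heawood graph. The class $\mathcal{F}$ consists of all graphs $G$ for which there is a sequence $G_0,G_1,\dots,G_m$ with $G_0\in\{H_0,K_{3,3}\}$, $G_m=G$, and, for each $i$, $G_{i+1}$ is a star product $(G_i,u)*(H,v)$ for some $H\in\{H_0,K_{3,3}\}$ and some vertices $u\in V(G_i)$, $v\in V(H)$. *)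

(* Defs.v *)
From HB Require Import structures.
From mathcomp Require Import all_boot all_order all_algebra.

Set Implicit Arguments.
Unset Strict Implicit.
Unset Printing Implicit Defensive.

Record sgraph := SGraph {
  vert :> finType;
  adj : rel vert;
  adj_sym : symmetric adj;
  adj_irr : irreflexive adj }.

Section SymmetricClosure.
Variables (T : finType) (e : rel T).

Definition sym_adj : rel T := [rel x y | (x != y) && (e x y || e y x)].

Lemma sym_adj_sym : symmetric sym_adj.
Proof. by move=> x y; rewrite /sym_adj /= eq_sym orbC. Qed.

Lemma sym_adj_irr : irreflexive sym_adj.
Proof. by move=> x; rewrite /sym_adj /= eqxx. Qed.

Definition mkgraph : sgraph := SGraph sym_adj_sym sym_adj_irr.

End SymmetricClosure.

Definition isomorphic (G H : sgraph) : Prop :=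
  exists2 f : G -> H, bijective f & forall x y, adj (f x) (f y) = adj x y.

Definition neighbours (G : sgraph) (x : G) : {set G} := [set y | adj x y].

Definition cubic (G : sgraph) : Prop := forall x : G, #|neighbours x| = 3.

Definition edges (G : sgraph) : {set {set G}} :=
  [set [set p.1; p.2] | p : G * G & adj p.1 p.2].

Definition matching (G : sgraph) (M : {set {set G}}) : bool :=
  (M \subset edges G) && trivIset M.

(* Only the edges of M are deleted; the vertex set of G - M is that of G. *)
Definition del_adj (G : sgraph) (M : {set {set G}}) : rel G :=
  [rel x y | adj x y && ([set x; y] \notin M)].

Definition separating (G : sgraph) (M : {set {set G}}) : bool :=
  n_comp (@adj G) predT < n_comp (del_adj M) predT.

Definition mms (G : sgraph) : nat :=
  \max_(M : {set {set G}} | matching M && separating M) #|M|.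

(* The joining matching is {x, f x} for x a neighbour of u; the values of f
   elsewhere are irrelevant. *)
Definition star_rel (G1 G2 : sgraph) (u : G1) (v : G2) (f : G1 -> G2) :
    rel ({x : G1 | x != u} + {y : G2 | y != v})%type :=
  fun a b => match a, b with
  | inl x, inl y => adj (val x) (val y)
  | inr x, inr y => adj (val x) (val y)
  | inl x, inr y => adj u (val x) && (val y == f (val x))
  | inr _, inl _ => false
  end.

Definition star_product (G1 G2 : sgraph) (u : G1) (v : G2) (f : G1 -> G2) :
  sgraph := mkgraph (@star_rel G1 G2 u v f).

Definition is_star_product (G1 : sgraph) (u : G1) (G2 : sgraph) (v : G2)
    (G : sgraph) : Prop :=
  [/\ cubic G1, cubic G2 &
   exists f : G1 -> G2,
     [/\ {in neighbours u &, injective f},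
         f @: neighbours u = neighbours v
       & isomorphic G (star_product u v f)]].

Definition Kbip_rel (m n : nat) : rel ('I_m + 'I_n)%type :=
  fun a b => match a, b with inl _, inr _ => true | _, _ => false end.

Definition Kbip (m n : nat) : sgraph := mkgraph (@Kbip_rel m n).

(* Incidence graph of the Fano plane: the points are the residues mod 7, and
   line j is {j, j + 1, j + 3}. *)
Definition heawood_rel : rel ('I_7 + 'I_7)%type :=
  fun a b => match a, b with
  | inl p, inr l => val p \in [seq (l + d) %% 7 | d <- [:: 0; 1; 3]]
  | _, _ => false
  end.

Definition heawood : sgraph := mkgraph heawood_rel.

Definition is_block (H : sgraph) : Prop := H = heawood \/ H = Kbip 3 3.

Inductive classF : sgraph -> Prop :=
| classF_base (G H : sgraph) : is_block H -> isomorphic G H -> classF G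
| classF_step (G H G' : sgraph) (u : G) (v : H) :
    classF G -> is_block H -> is_star_product u v G' -> classF G'.

Definition Fbar0 : sgraph := Kbip 3 3.

(* In Kbip 2 3 the degree-2 vertices are the inr i.  All perfect matchings
   between them are equivalent under its automorphisms, so the one joining equal
   indices is used. *)
Definition Fbar1_rel : rel (Kbip 2 3 + Kbip 2 3)%type :=
  fun a b => match a, b with
  | inl x, inl y => adj x y
  | inr x, inr y => adj x y
  | inl (inr i), inr (inr j) => i == j
  | _, _ => false
  end.

Definition Fbar1 : sgraph := mkgraph Fbar1_rel.

Definition Fbar2_rel : rel (Kbip 1 3 + (Kbip 2 3 + Kbip 2 3))%type :=
  fun a b => match a, b with
  | inl x, inl y => adj x y
  | inr (inl x), inr (inl y) => adj x y
  | inr (inr x), inr (inr y) => adj x y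
  | inl (inr i), inr (inl (inr j)) => i == j
  | inl (inr i), inr (inr (inr j)) => i == j
  | _, _ => false
  end.

Definition Fbar2 : sgraph := mkgraph Fbar2_rel.

Definition Fbar3_rel : rel ('I_3 + ('I_3 * Kbip 2 3))%type :=
  fun a b => match a, b with
  | inr (k, x), inr (l, y) => (k == l) && adj x y
  | inl i, inr (_, inr j) => i == j
  | _, _ => false
  end.

Definition Fbar3 : sgraph := mkgraph Fbar3_rel.

(* Main.v *)
Require Import Defs.
From mathcomp Require Import all_boot all_order all_algebra perm.

Set Implicit Arguments.
Unset Strict Implicit.
Unset Printing Implicit Defensive.

(* A separating matching of size at least n/2 - 1 is a matching missing at most
   two vertices together with a nonconstant 2-colouring of the vertices all of
   whose bichromatic edges are matched.  Such a pair survives a star product with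
   a graph H all of whose edges lie in perfect matchings: colour H - v like u and
   complete the matching inside H.  Even several matched edges at u may be allowed,
   each edge beyond the first exposing one more vertex of H - v.  Every graph of F
   has all its edges in perfect matchings and the Heawood graph has such a pair,
   so only products of copies of K_{3,3} remain; there each vertex of Fbar0, ...,
   Fbar3 either admits a pair with several matched edges at that vertex, or its
   expansion is the next exceptional graph. *)

(** * Matchings as involutions and cuts as 2-colourings *)

(** Fixed points of the involution encode the unmatched vertices. *)
Definition is_matching_map (G : sgraph) (m : G -> G) : Prop :=
  involutive m /\ forall x, m x != x -> adj x (m x).

Definition perfect_map (G : sgraph) (m : G -> G) : Prop :=
  involutive m /\ forall x, adj x (m x).

Definition edge_matchable (G : sgraph) : Prop :=
  forall x y : G, adj x y -> exists2 m, perfect_map m & m x = y.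

Definition connected (G : sgraph) : Prop :=
  forall c : G -> bool, (forall x y, adj x y -> c x = c y) ->
  forall x y, c x = c y.

Definition connected_without (G : sgraph) (u : G) : Prop :=
  forall c : G -> bool,
  (forall x y, x != u -> y != u -> adj x y -> c x = c y) ->
  forall x y, x != u -> y != u -> c x = c y.

Definition cut_matchable (G : sgraph) : Prop :=
  exists m : G -> G, exists c : G -> bool,
  [/\ is_matching_map m, #|[set x | m x == x]| <= 2, exists x y, c x != c y
    & forall x y, adj x y -> c x != c y -> m x = y].

(* A matching in which any number of neighbours of u may be matched to u;
   the value of m at u is irrelevant. *)
Definition near_matching (G : sgraph) (u : G) (m : G -> G) : Prop :=
  forall x, x != u ->
    (m x != x -> adj x (m x)) /\ (m x != u -> m (m x) = x).

Definition exposed (G : sgraph) (u : G) (m : G -> G) : {set G} :=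
  [set x | (x != u) && (m x == x)].

Definition attached (G : sgraph) (u : G) (m : G -> G) : {set G} :=
  [set x | (x != u) && (m x == u)].

(* The number of vertices that must stay exposed when u is replaced by H - v and
   k of the three edges leaving H - v are matched. *)
Definition defect (k : nat) : nat := if k is k'.+1 then k' else 1.

(** The bound anticipates a star product at [u]: exposed vertices of G - u plus those forced in H -
    v. Since [m u] is irrelevant, a bichromatic edge at [u] is tested from its other end only. *)
Definition cut_matchable_at (G : sgraph) (u : G) : Prop :=
  exists m : G -> G, exists c : G -> bool,
  [/\ near_matching u m, #|exposed u m| + defect #|attached u m| <= 2,
      exists x y, c x != c y
    & forall x y, x != u -> adj x y -> c x != c y -> m x = y].

Lemma adjC (G : sgraph) (x y : G) : adj x y = adj y x.
Proof. exact: adj_sym. Qed.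

Lemma adj_neq (G : sgraph) (x y : G) : adj x y -> x != y.
Proof. by apply: contraTneq => ->; rewrite adj_irr. Qed.

(** * Invariance under isomorphism *)

Section Isomorphism.
Variables (G H : sgraph).

Lemma isomorphic_trans K : isomorphic G H -> isomorphic H K -> isomorphic G K.
Proof.
case=> f fB fA [g gB gA]; exists (g \o f); first exact: bij_comp.
by move=> x y; rewrite /= gA fA.
Qed.

Hypothesis isoGH : isomorphic G H.

Lemma edge_matchable_iso : edge_matchable H -> edge_matchable G.
Proof.
case: isoGH => f [g fK gK] fA emH x y; rewrite -fA => /emH [m [mK mA] mxy].
exists (g \o m \o f); last by rewrite /= mxy fK.
split=> z; first by rewrite /= gK mK fK.
by rewrite -fA /= gK.
Qed.

Lemma connected_iso : connected H -> connected G.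
Proof.
case: isoGH => f [g fK gK] fA cH c cA x y.
rewrite -[x]fK -[y]fK; apply: (cH (c \o g)) => a b ab /=.
by apply: cA; rewrite -fA !gK.
Qed.

Lemma cut_matchable_iso : cut_matchable H -> cut_matchable G.
Proof.
case: isoGH => f [g fK gK] fA [m [c [[mK mA] m2 [a [b cab]] cut]]].
exists (g \o m \o f), (c \o f); split.
- split=> z; first by rewrite /= gK mK fK.
  rewrite -fA /= gK (can2_eq gK fK); exact: mA.
- apply: leq_trans m2; rewrite -(card_imset _ (can_inj fK)).
  apply/subset_leq_card/subsetP => _ /imsetP [x + ->].
  by rewrite !inE /= (can2_eq gK fK).
- by exists (g a), (g b); rewrite /= !gK.
- by move=> x y; rewrite -fA => /cut cutxy /cutxy /= ->; rewrite fK.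
Qed.

End Isomorphism.

(** * Matchings seen from one vertex *)

Section NearMatchings.
Variables (G : sgraph) (u : G).

Lemma attached_adj m x : near_matching u m -> x \in attached u m -> adj u x.
Proof.
rewrite inE adjC => nm /andP [xu /eqP mx].
by case: (nm x xu) => + _; rewrite mx eq_sym => /(_ xu).
Qed.

Lemma perfect_near_matching m : perfect_map m ->
  [/\ near_matching u m, exposed u m = set0 & attached u m = [set m u]].
Proof.
case=> mK mA; split.
- by move=> x _; split.
- apply/setP => x; rewrite !inE [m x == x]eq_sym.
  by rewrite (negPf (adj_neq (mA x))) andbF.
- apply/setP => x; rewrite !inE (can2_eq mK mK).
  by case: (eqVneq x (m u)) => [->|_]; rewrite ?andbF // andbT eq_sym adj_neq.
Qed.

(** If [u] is unmatched, nothing is attached and [defect 0 = 1] accounts for [u] itself; otherwise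
    only [m u] is attached and [defect 1 = 0]. *)
Lemma cut_matchable_at_of : cut_matchable G -> cut_matchable_at u.
Proof.
case=> m [c [[mK mA] m2 cc cut]]; exists m, c; split=> //.
- by move=> x _; split=> [/mA|_] //; apply: mK.
- have eqA : attached u m = [set m u] :\ u.
    by apply/setP => x; rewrite !inE (can2_eq mK mK).
  have [mu|mu] := eqVneq (m u) u.
    rewrite eqA mu setDv cards0 addn1 ltnS -ltnS.
    apply: leq_trans m2; rewrite [in X in _ < X](cardsD1 u) inE mu eqxx ltnS.
    by apply/subset_leq_card/subsetP => x; rewrite !inE.
  rewrite eqA (_ : _ :\ u = [set m u]) ?cards1 ?addn0.
    apply: leq_trans m2.
    by apply/subset_leq_card/subsetP => x; rewrite !inE => /andP [].
  by apply/setP => x; rewrite !inE; case: (eqVneq x (m u)) => [->|_];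
    rewrite ?mu ?andbF.
- by move=> x y _; apply: cut.
Qed.

(* Starting from a perfect matching through an edge of S, all other vertices of
   S are rematched to u, which exposes their former partners. *)
Lemma near_matching_attached (S : {set G}) :
    edge_matchable G -> (exists w, adj u w) -> S \subset neighbours u ->
  exists m, [/\ near_matching u m, #|exposed u m| <= defect #|S|
              & attached u m = S].
Proof.
move=> emG [w uw] /subsetP SN.
have adjS x : x \in S -> adj u x by move/SN; rewrite inE.
have S0 x : x \in S -> x != u by move/adjS; rewrite adjC => /adj_neq.
have [->|[s sS]] := set_0Vmem S.
  have [m [mK mA] mu] := emG _ _ uw.
  have mw : m w = u by rewrite -mu mK.
  (* With nothing attached, the edge from [u] to [w] is dropped from a perfect matching, which
     exposes just [w]. *)
  exists (fun x => if x == w then x else m x); split.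
  - move=> x xu; case: (eqVneq x w) => [->|xw]; rewrite ?eqxx //.
    split=> // _; case: eqVneq => [mxw|_]; last exact: mK.
    by rewrite -(mK x) mxw mw eqxx in xu.
  - rewrite cards0 /= -(cards1 w).
    apply/subset_leq_card/subsetP => x; rewrite !inE.
    case: (eqVneq x w) => // xw /andP [_].
    by rewrite eq_sym (negPf (adj_neq (mA x))).
  - apply/setP => x; rewrite !inE; case: (eqVneq x w) => [->|xw].
      by rewrite andNb.
    by rewrite (can2_eq mK mK) mu (negPf xw) andbF.
have [m [mK mA] mu] := emG _ _ (adjS s sS).
have ms : m s = u by rewrite -mu mK.
exists (fun x => if x \in S then u else if m x \in S then x else m x); split.
- move=> x xu; have [xS|xS] := boolP (x \in S).
    by rewrite eqxx; split=> // _; rewrite adjC adjS.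
  have [mxS|mxS] := boolP (m x \in S).
    by rewrite !eqxx (negPf xS) mxS.
  by split=> [_|_]; rewrite ?mA // (negPf mxS) mK (negPf xS).
(* The old matching sends the exposed vertices injectively into [S] minus [s], the element that was
   already matched to [u]. *)
- rewrite [#|S|](cardsD1 s) sS /= -(card_imset _ (can_inj mK)).
  apply/subset_leq_card/subsetP => _ /imsetP [x + ->]; rewrite !inE.
  case/andP => xu; case: (boolP (x \in S)) => xS.
    by rewrite eq_sym (negPf xu).
  case: (boolP (m x \in S)) => mxS; last first.
    by rewrite eq_sym (negPf (adj_neq (mA x))).
  by rewrite andbT (can2_eq mK mK) ms xu.
- apply/setP => x; rewrite inE; have [xS|xS] := boolP (x \in S).
    by rewrite eqxx S0.
  case: (boolP (m x \in S)) => mxS; first by rewrite andNb.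
  rewrite (can2_eq mK mK) mu; apply/negbTE; rewrite negb_and.
  by apply/orP; right; apply: contraNneq xS => ->.
Qed.

End NearMatchings.

(** * Gluing matchings and colourings along a star product *)

Section StarProduct.
Variables (G H : sgraph) (u : G) (v : H) (f : G -> H).
Let S := star_product u v f.
Implicit Types (x y : {x : G | x != u}) (z w : {y : H | y != v}).

Lemma star_adj_ll x y : adj (inl x : S) (inl y) = adj (val x) (val y).
Proof.
transitivity ((inl x != inl y :> S) &&
  (adj (val x) (val y) || adj (val y) (val x))) => //.
rewrite [adj (val y) _]adjC orbb andb_idl // => /adj_neq.
by apply: contraNneq => -[->].
Qed.

Lemma star_adj_rr z w : adj (inr z : S) (inr w) = adj (val z) (val w).
Proof.
transitivity ((inr z != inr w :> S) &&
  (adj (val z) (val w) || adj (val w) (val z))) => //.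
rewrite [adj (val w) _]adjC orbb andb_idl // => /adj_neq.
by apply: contraNneq => -[->].
Qed.

Lemma star_adj_lr x z :
  adj (inl x : S) (inr z) = adj u (val x) && (val z == f (val x)).
Proof. exact: orbF. Qed.

Lemma star_adj_rl x z :
  adj (inr z : S) (inl x) = adj u (val x) && (val z == f (val x)).
Proof. by []. Qed.

Hypothesis finj : {in neighbours u &, injective f}.
Hypothesis fim : f @: neighbours u = neighbours v.

Lemma star_fun_adj (x : G) : adj u x -> adj v (f x).
Proof.
move=> ux; have : f x \in f @: neighbours u by rewrite imset_f // inE.
by rewrite fim inE.
Qed.

(** Inverse of the joining bijection; the default [u] occurs only off the neighbours of [v]. *)
Definition star_inv (y : H) : G := odflt u [pick x : G | adj u x && (f x == y)].

Lemma star_funK (x : G) : adj u x -> star_inv (f x) = x.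
Proof.
move=> ux; rewrite /star_inv; case: pickP => [y /andP [uy /eqP fxy]|].
  by apply: finj; rewrite ?inE.
by move=> /(_ x); rewrite ux eqxx.
Qed.

Lemma star_invP (y : H) : adj v y -> adj u (star_inv y) /\ f (star_inv y) = y.
Proof.
move=> vy; have : y \in f @: neighbours u by rewrite fim inE.
by case/imsetP => x; rewrite inE => ux ->; rewrite star_funK.
Qed.

Section Glue.
Variables (m1 : G -> G) (m2 : H -> H).
Hypotheses (nm1 : near_matching u m1) (nm2 : near_matching v m2).
Hypothesis att : f @: attached u m1 = attached v m2.

(** A failing [insub] detects that the partner is the deleted vertex; the vertex is then matched
    across the joining edge. By [att] both ends of that edge agree to this, so the last default [a]
    never occurs. *)
Definition star_glue (a : S) : S :=
  match a with
  | inl x => if insub (m1 (val x)) is Some y then inl y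
             else if insub (f (val x)) is Some z then inr z else a
  | inr z => if insub (m2 (val z)) is Some w then inr w
             else if insub (star_inv (val z)) is Some x then inl x else a
  end.

Lemma star_glue_ll x y : m1 (val x) = val y -> star_glue (inl x) = inl y.
Proof. by move=> /= ->; rewrite valK. Qed.

Lemma star_glue_rr z w : m2 (val z) = val w -> star_glue (inr z) = inr w.
Proof. by move=> /= ->; rewrite valK. Qed.

Lemma star_glue_lr x z :
  m1 (val x) = u -> f (val x) = val z -> star_glue (inl x) = inr z.
Proof. by move=> /= -> ->; rewrite insubN ?eqxx // valK. Qed.

Lemma star_glue_rl x z :
  m1 (val x) = u -> f (val x) = val z -> star_glue (inr z) = inl x.
Proof.
move=> m1x fx; have xA : val x \in attached u m1 by rewrite inE (valP x) m1x eqxx.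
have : f (val x) \in attached v m2 by rewrite -att imset_f.
rewrite inE fx => /andP [_ /eqP /= ->]; rewrite insubN ?eqxx // -fx.
by rewrite star_funK ?valK // (attached_adj nm1).
Qed.

(** Each case records the pairing in both directions, so that one case analysis yields involutivity,
    adjacency and the fixed points. *)
Variant star_glue_spec (a : S) : S -> Prop :=
| StarGlueLL x y of a = inl x & m1 (val x) = val y & m1 (val y) = val x :
    star_glue_spec a (inl y)
| StarGlueRR z w of a = inr z & m2 (val z) = val w & m2 (val w) = val z :
    star_glue_spec a (inr w)
| StarGlueLR x z of a = inl x & m1 (val x) = u & f (val x) = val z :
    star_glue_spec a (inr z)
| StarGlueRL x z of a = inr z & m1 (val x) = u & f (val x) = val z :
    star_glue_spec a (inl x).

Lemma star_glueP a : star_glue_spec a (star_glue a).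
Proof.
case: a => [x|z].
  have [m1x|m1x] := eqVneq (m1 (val x)) u.
    have xA : val x \in attached u m1 by rewrite inE (valP x) m1x eqxx.
    have : f (val x) \in attached v m2 by rewrite -att imset_f.
    rewrite inE => /andP [fv _]; pose z : {y | y != v} := Sub (f (val x)) fv.
    by rewrite (star_glue_lr (z := z)) //; apply: (@StarGlueLR _ x).
  pose y : {x | x != u} := Sub (m1 (val x)) m1x.
  rewrite (star_glue_ll (y := y)) //; apply: (@StarGlueLL _ x) => //.
  by case: (nm1 (valP x)) => _; apply.
have [m2z|m2z] := eqVneq (m2 (val z)) v.
  have: val z \in attached v m2 by rewrite inE (valP z) m2z eqxx.
  rewrite -att => /imsetP [x]; rewrite inE => /andP [xu /eqP m1x] zE.
  by rewrite (star_glue_rl (x := Sub x xu)) //; apply: (@StarGlueRL _ _ z).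
pose w : {y | y != v} := Sub (m2 (val z)) m2z.
rewrite (star_glue_rr (w := w)) //; apply: (@StarGlueRR _ z) => //.
by case: (nm2 (valP z)) => _; apply.
Qed.

Lemma star_glueK : involutive star_glue.
Proof.
move=> a; case: (star_glueP a) => [x y|z w|x z|x z] -> m fx.
- exact: star_glue_ll.
- exact: star_glue_rr.
- exact: star_glue_rl.
- exact: star_glue_lr.
Qed.

Lemma star_glue_matching : is_matching_map star_glue.
Proof.
split=> [|a]; first exact: star_glueK.
case: (star_glueP a) => [x y|z w|x z|x z] -> m fx.
- case: (nm1 (valP x)) => + _ nxy; rewrite m star_adj_ll; apply.
  by apply: contraNneq nxy => /val_inj ->.
- case: (nm2 (valP z)) => + _ nxy; rewrite m star_adj_rr; apply.
  by apply: contraNneq nxy => /val_inj ->.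
- rewrite star_adj_lr fx eqxx andbT (attached_adj nm1) //.
  by rewrite inE (valP x) m eqxx.
- rewrite star_adj_rl fx eqxx andbT (attached_adj nm1) //.
  by rewrite inE (valP x) m eqxx.
Qed.

(** A vertex matched across is never fixed, so every fixed point is exposed in its own factor. *)
Lemma star_glue_exposed :
  #|[set a | star_glue a == a]| <= #|exposed u m1| + #|exposed v m2|.
Proof.
pose p (a : S) : G + H :=
  match a with inl x => inl (val x) | inr z => inr (val z) end.
have pinj : injective p.
  by move=> [x|z] [y|w] //= [/val_inj ->].
have <- : #|inl @: exposed u m1 :|: inr @: exposed v m2| =
          #|exposed u m1| + #|exposed v m2|.
  rewrite cardsU !card_imset; [|by move=> ? ? []..].
  rewrite (_ : _ :&: _ = set0) ?cards0 ?subn0 //.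
  apply/setP => a; rewrite !inE; apply/negP => /andP [/imsetP [? _ ->]].
  by case/imsetP.
rewrite -(card_imset _ pinj); apply/subset_leq_card/subsetP => _ /imsetP [a + ->].
rewrite !inE; case: (star_glueP a) => [x y|z w|x z|x z] -> m fx // /eqP [] /= yx.
- by rewrite imset_f // inE (valP x) m yx /=.
- by rewrite orbC imset_f // inE (valP z) m yx /=.
Qed.

End Glue.

(** Perfect matchings glue when their edges at [u] and [v] correspond under [f]. An edge inside one
    factor fixes a matching there, hence the joining edge to be used, and the other factor has a
    perfect matching through the corresponding edge. *)
Lemma star_edge_matchable :
  edge_matchable G -> edge_matchable H -> edge_matchable S.
Proof.
move=> emG emH.
have glue m1 m2 : perfect_map m1 -> perfect_map m2 -> f (m1 u) = m2 v ->
    perfect_map (star_glue m1 m2) /\ f @: attached u m1 = attached v m2.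
  move=> pm1 pm2 fm.
  have [nm1 e1 a1] := perfect_near_matching u pm1.
  have [nm2 e2 a2] := perfect_near_matching v pm2.
  have att : f @: attached u m1 = attached v m2.
    by rewrite a1 a2 imset_set1 fm.
  split=> //; have [mK mA] := star_glue_matching nm1 nm2 att.
  split=> // a; apply: mA; apply/negP => fixa.
  have := star_glue_exposed nm1 nm2 att; rewrite e1 e2 !cards0 leqn0 cards_eq0.
  by move/eqP/setP/(_ a); rewrite !inE fixa.
have lr x z : adj u (val x) -> val z = f (val x) ->
    exists2 m, perfect_map m & m (inl x : S) = inr z.
  move=> ux zE; have [m1 pm1 m1u] := emG _ _ ux.
  have [m2 pm2 m2v] := emH _ _ (star_fun_adj ux).
  have [|pm _] := glue m1 m2 pm1 pm2; first by rewrite m1u m2v.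
  exists (star_glue m1 m2) => //; apply: star_glue_lr => //.
  by rewrite -m1u; case: pm1 => ->.
move=> [x|z] [y|w].
- rewrite star_adj_ll => xy; have [m1 pm1 m1x] := emG _ _ xy.
  have um1 : adj u (m1 u) by case: pm1.
  have [m2 pm2 m2v] := emH _ _ (star_fun_adj um1).
  have [//|pm _] := glue m1 m2 pm1 pm2.
  by exists (star_glue m1 m2) => //; apply: star_glue_ll.
- by rewrite star_adj_lr => /andP [ux /eqP wx]; apply: lr.
- rewrite star_adj_rl => /andP [ux /eqP wx]; have [m [mK mA] mE] := lr _ _ ux wx.
  by exists m; rewrite -?mE ?mK.
- rewrite star_adj_rr => zw; have [m2 pm2 m2z] := emH _ _ zw.
  have vm2 : adj v (m2 v) by case: pm2.
  have [ui fi] := star_invP vm2; have [m1 pm1 m1u] := emG _ _ ui.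
  have [|pm _] := glue m1 m2 pm1 pm2; first by rewrite m1u.
  by exists (star_glue m1 m2) => //; apply: star_glue_rr.
Qed.

(** With H - v coloured like [u], the bichromatic edges are those of G, an edge at [u] becoming the
    joining edge. [near_matching_attached] supplies a matching of H with exactly the required
    attached vertices. *)
Lemma star_cut_matchable : (exists t, adj u t) ->
  cut_matchable_at u -> edge_matchable H -> cut_matchable S.
Proof.
move=> [t ut] [m1 [c [nm1 e1 [a [b cab]] cut]]] emH.
have attN : f @: attached u m1 \subset neighbours v.
  rewrite -fim; apply: imsetS; apply/subsetP => x; rewrite [in X in _ -> X]inE.
  exact: attached_adj.
have vft := star_fun_adj ut.
have vN : exists y : H, adj v y by exists (f t).
have [m2 [nm2 e2 a2]] := near_matching_attached emH vN attN.
have attE : #|f @: attached u m1| = #|attached u m1|.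
  apply: card_in_imset => x y xA yA; apply: finj; rewrite inE.
    exact: attached_adj xA.
  exact: attached_adj yA.
pose c' (s : S) := if s is inl x then c (val x) else c u.
exists (star_glue m1 m2), c'; split.
- exact: star_glue_matching.
- apply: leq_trans (star_glue_exposed nm1 nm2 (esym a2)) _.
  by apply: leq_trans e1; rewrite leq_add2l -attE.
(* The colouring stays nonconstant after [u] is deleted, because H - v is nonempty and inherits the
   colour of [u]. *)
- have [x cxu] : exists x : G, c x != c u.
    have [cau|] := eqVneq (c a) (c u); last by exists a.
    by exists b; rewrite -cau eq_sym.
  have xu : x != u by apply: contraNneq cxu => ->.
  have fv : f t != v by rewrite eq_sym adj_neq.
  by exists (inl (Sub x xu)), (inr (Sub (f t) fv)).
have lr x z : adj u (val x) -> val z = f (val x) -> c (val x) != c u ->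
    star_glue m1 m2 (inl x) = inr z.
  move=> ux zE cx; apply: star_glue_lr => //.
  by apply: cut; rewrite ?(valP x) // adjC.
move=> [x|z] [y|w].
- rewrite star_adj_ll => xy cxy; apply: (@star_glue_ll m1 m2).
  by apply: cut; rewrite ?(valP x).
- by rewrite star_adj_lr /= => /andP [ux /eqP wx]; apply: lr.
- rewrite star_adj_rl => /andP [ux /eqP wx]; rewrite eq_sym => cx.
  by rewrite -(lr _ _ ux wx cx) star_glueK.
- by rewrite /= eqxx.
Qed.

(** Contracting the connected part H - v to a single vertex gives back G. *)
Lemma star_connected : (exists t, adj u t) ->
  connected G -> connected_without v -> connected S.
Proof.
move=> [t ut] cG cH c cA.
have fv (x : G) : adj u x -> f x != v.
  by move/star_fun_adj; rewrite eq_sym; apply: adj_neq.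
pose z0 : {y | y != v} := Sub (f t) (fv t ut).
have cr z : c (inr z) = c (inr z0).
  pose c2 (y : H) := if insub y is Some z then c (inr z) else false.
  have c2E w : c2 (val w) = c (inr w) by rewrite /c2 valK.
  rewrite -!c2E; apply: cH; rewrite ?(valP z) ?(valP z0) //.
  move=> x y xv yv xy; rewrite (c2E (Sub x xv)) (c2E (Sub y yv)).
  by apply: cA; rewrite star_adj_rr.
have cl x : c (inl x) = c (inr z0).
  (* The deleted vertex [u] receives the common colour of H - v. *)
  pose c1 (y : G) := if insub y is Some x then c (inl x) else c (inr z0).
  have c1E y : c1 (val y) = c (inl y) by rewrite /c1 valK.
  have c1u : c1 u = c (inr z0) by rewrite /c1 insubN ?eqxx.
  have c1n (y : G) : adj u y -> c1 y = c1 u.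
    move=> uy; have yu : y != u by rewrite eq_sym adj_neq.
    rewrite c1u (c1E (Sub y yu)) -(cr (Sub (f y) (fv y uy))).
    by apply: cA; rewrite star_adj_lr uy eqxx.
  rewrite -c1E -c1u; apply: cG => a b ab.
  have [au|au] := eqVneq a u; first by rewrite au c1n // -au.
  have [bu|bu] := eqVneq b u; first by rewrite bu c1n // -bu adjC.
  by rewrite (c1E (Sub a au)) (c1E (Sub b bu)); apply: cA; rewrite star_adj_ll.
by move=> [x|z] [y|w]; rewrite ?cl ?cr.
Qed.

Lemma star_inv_inj : {in neighbours v &, injective star_inv}.
Proof.
move=> y z; rewrite !inE => /star_invP [_ yE] /star_invP [_ zE] yz.
by rewrite -yE yz zE.
Qed.

Lemma star_inv_im : star_inv @: neighbours v = neighbours u.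
Proof.
rewrite -fim -imset_comp; apply/setP => x; apply/imsetP/idP => [[y]|xN].
  by rewrite inE => uy -> /=; rewrite star_funK ?inE.
by exists x => //=; rewrite star_funK //; rewrite inE in xN.
Qed.

End StarProduct.

(** * Symmetry and transport of star products *)

(** This allows the separating pair to come from the second factor instead of the first. *)
Lemma star_swap (G H : sgraph) (u : G) (v : H) (f : G -> H) :
    {in neighbours u &, injective f} -> f @: neighbours u = neighbours v ->
  isomorphic (star_product u v f) (star_product v u (star_inv u f)).
Proof.
move=> finj fim.
exists (fun a : star_product u v f =>
  match a with inl x => inr x | inr z => inl z end
  : star_product v u (star_inv u f)).
  by exists (fun a => match a with inl x => inr x | inr z => inl z end); case.
have E (x : {x | x != u}) (z : {y | y != v}) :
    adj v (val z) && (val x == star_inv u f (val z)) =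
    adj u (val x) && (val z == f (val x)).
  apply/andP/andP => -[vz /eqP E].
    by have [uz fz] := star_invP finj fim vz; rewrite E uz fz.
  by rewrite E (star_fun_adj fim) // (star_funK finj).
move=> [x|z] [y|w].
- by rewrite star_adj_rr star_adj_ll.
- by rewrite star_adj_rl star_adj_lr.
- by rewrite star_adj_lr star_adj_rl.
- by rewrite star_adj_rr star_adj_ll.
Qed.

Lemma star_iso_l (G G' H : sgraph) (u : G) (v : H) (f : G -> H)
    (h : G -> G') (k : G' -> G) :
    cancel h k -> cancel k h -> (forall x y, adj (h x) (h y) = adj x y) ->
  isomorphic (star_product u v f) (star_product (h u) v (f \o k)).
Proof.
move=> hK kK hA.
have hu x : x != u -> h x != h u by rewrite (inj_eq (can_inj hK)).
have ku x : x != h u -> k x != u by rewrite (can2_eq kK hK).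
exists (fun a : star_product u v f => match a with
  | inl x => inl (Sub (h (val x)) (hu _ (valP x))) | inr z => inr z end
  : star_product (h u) v (f \o k)).
  exists (fun a : star_product (h u) v (f \o k) => match a with
    | inl x => inl (Sub (k (val x)) (ku _ (valP x))) | inr z => inr z end
    : star_product u v f).
    by case=> // x; congr inl; apply: val_inj; rewrite /= hK.
  by case=> // x; congr inl; apply: val_inj; rewrite /= kK.
move=> [x|z] [y|w].
- by rewrite !star_adj_ll hA.
- by rewrite !star_adj_lr /= hA hK.
- by rewrite !star_adj_rl /= hA hK.
- by rewrite !star_adj_rr.
Qed.

(** * From involutions to separating matchings and [mms] *)

Section MatchingSize.
Variables (G : sgraph) (m : G -> G).
Hypothesis mm : is_matching_map m.

Definition matching_of : {set {set G}} :=
  [set [set x; m x] | x in [set x | m x != x]].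

Lemma matching_of_eq x y a :
  a \in [set x; m x] -> a \in [set y; m y] -> [set x; m x] = [set y; m y].
Proof.
have [mK _] := mm.
have E z : a \in [set z; m z] -> [set z; m z] = [set a; m a].
  by rewrite !inE => /orP [] /eqP -> //; rewrite mK setUC.
by move=> /E -> /E ->.
Qed.

Lemma cover_matching_of : cover matching_of = [set x | m x != x].
Proof.
have [mK _] := mm; rewrite cover_imset; apply/setP => x; apply/bigcupP/idP.
  case=> y; rewrite !inE => my /orP [] /eqP -> //.
  by rewrite mK eq_sym.
by move=> mx; exists x; rewrite // !inE eqxx.
Qed.

Lemma matching_ofP : matching matching_of.
Proof.
have [mK mA] := mm; apply/andP; split.
  apply/subsetP => _ /imsetP [x + ->]; rewrite inE => /mA xmx.
  by apply: (imset_f (fun p : G * G => [set p.1; p.2]) (x := (x, m x)));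
    rewrite inE.
apply/trivIsetP => _ _ /imsetP [x _ ->] /imsetP [y _ ->] neq.
rewrite -setI_eq0; apply/eqP/setP => a; rewrite in_set0 in_setI.
by apply: contraNF neq => /andP [/matching_of_eq ax /ax ->].
Qed.

Lemma card_matching_of : #|G| = #|matching_of| * 2 + #|[set x | m x == x]|.
Proof.
have [mK mA] := mm; have /andP [_ triv] := matching_ofP.
rewrite -(cardsC [set x | m x == x]) addnC; congr (_ + _).
rewrite (_ : ~: _ = [set x | m x != x]); last by apply/setP => x; rewrite !inE.
apply: card_uniform_partition.
  by move=> _ /imsetP [x + ->]; rewrite inE eq_sym => xm; rewrite cards2 xm.
apply/and3P; split=> //; first by rewrite cover_matching_of.
by apply/imsetP => -[x _ /setP /(_ x)]; rewrite !inE eqxx.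
Qed.

(** The colouring is constant on the components of G - M yet takes two values, while G has a single
    component. *)
Lemma matching_of_separating (c : G -> bool) :
    connected G -> (exists x y, c x != c y) ->
    (forall x y, adj x y -> c x != c y -> m x = y) ->
  separating matching_of.
Proof.
move=> cG [a [b cab]] cut.
have conn x y : connect (@adj G) x y.
  (* The set reachable from [x] is closed under adjacency, so its indicator is constant. *)
  rewrite -(cG (connect (@adj G) x) _ x y) ?connect0 // => s t st.
  apply/idP/idP => xs; apply: connect_trans xs (connect1 _) => //.
  by rewrite adjC.
have symd : connect_sym (del_adj matching_of).
  apply/sym_connect_sym => x y; rewrite /del_adj /= adjC.
  by rewrite [[set x; y]]setUC.
have ndab : ~~ connect (del_adj matching_of) a b.
  apply: contraNN cab => /(closed_connect (a := [pred x | c x])).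
  rewrite !inE => -> // x y /andP [xy xyM]; rewrite !inE.
  apply/eqP; apply: contraNT xyM => cxy; have mx := cut _ _ xy cxy.
  apply/imsetP; exists x; rewrite ?mx // inE mx eq_sym; exact: adj_neq.
rewrite /separating; apply: (@leq_ltn_trans 1).
  apply/card_le1P => x; rewrite !inE => /andP [/eqP rx _] y.
  rewrite !inE andbT; apply/idP/eqP => [/eqP ry|->]; last exact/eqP.
  rewrite -rx -ry; apply/(fingraph.rootP (sym_connect_sym (@adj_sym G))).
  exact: conn.
apply/card_gt1P; exists (fingraph.root (del_adj matching_of) a),
  (fingraph.root (del_adj matching_of) b).
by split; rewrite ?inE ?roots_root // root_connect.
Qed.

End MatchingSize.

(** The vertices number twice the matching plus at most two fixed points. *)
Lemma mms_ge (G : sgraph) :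
  connected G -> cut_matchable G -> #|G| <= mms G * 2 + 2.
Proof.
move=> cG [m [c [mm m2 cc cut]]]; rewrite (card_matching_of mm).
apply: leq_add => //; apply: leq_mul => //; rewrite /mms.
apply: (@bigop.leq_bigmax_cond _ _ (fun M : {set {set G}} => #|M|)).
by rewrite matching_ofP //= (matching_of_separating cG cc cut).
Qed.

Lemma connected_of_without (G : sgraph) (u : G) :
  (exists t, adj u t) -> connected_without u -> connected G.
Proof.
move=> [t ut] cu c cA.
have tu : t != u by rewrite eq_sym adj_neq.
have E x : c x = c t.
  have [->|xu] := eqVneq x u; first exact: cA.
  by apply: cu => // y z _ _; apply: cA.
by move=> x y; rewrite !E.
Qed.

(** * Recognising star products with K_{3,3} *)

Definition Kbip_index (n : nat) (x : Kbip n n) : 'I_n :=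
  match x with inl i => i | inr i => i end.

Lemma Kbip_adjE (m n : nat) (x y : Kbip m n) :
  adj x y = match x, y with
    | inl _, inl _ | inr _, inr _ => false | _, _ => true end.
Proof. by case: x y => a [b|b]; first [exact: andbF | by []]. Qed.

(** Adjacency to [x] tells the side of a vertex, and vertices are adjacent exactly when their sides
    differ. *)
Lemma Kbip_adj_addb (m n : nat) (x y z : Kbip m n) :
  adj y z = adj x y (+) adj x z.
Proof. by rewrite !Kbip_adjE; case: x y z => ? [?|?] [?|?]. Qed.

(** Renumbering the rest of the side of [x] by [unlift] turns K_{n,n} - x into K_{n-1,n}. *)
Lemma Kbip_same_side (n : nat) (x y : Kbip n n) : ~~ adj x y -> y != x ->
  exists2 i, unlift (Kbip_index x) (Kbip_index y) = Some i
    & y = if x is inl _ then inl (lift (Kbip_index x) i)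
          else inr (lift (Kbip_index x) i).
Proof.
rewrite Kbip_adjE; case: x y => a [b|b] //= _;
  case: (unliftP a b) => [i ->|-> /eqP //] _;
  by exists i.
Qed.

(** K_{3,3} - v is a K_{2,3} whose degree-2 vertices are the neighbours of [v]. Numbering these by
    their partners [w i] absorbs the choice of [f], so all joinings give the same graph X, made of G
    - u embedded by [h] and K_{2,3} embedded by [k]. *)
Lemma star_K33_iso (G X : sgraph) (u : G) (v : Kbip 3 3) (f : G -> Kbip 3 3)
    (h : G -> X) (k : Kbip 2 3 -> X) (w : 'I_3 -> G) :
    {in neighbours u &, injective f} -> f @: neighbours u = neighbours v ->
    (forall x, adj u x = [exists i, x == w i]) ->
    {in [pred x | x != u] &, injective h} -> injective k ->
    (forall x y, x != u -> h x != k y) ->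
    (forall x y, x != u -> y != u -> adj (h x) (h y) = adj x y) ->
    (forall x y, adj (k x) (k y) = adj x y) ->
    (forall x y, x != u ->
      adj (h x) (k y) = if y is inr i then x == w i else false) ->
    #|X| <= #|G| + 4 ->
  isomorphic (star_product u v f) X.
Proof.
move=> finj fim uw hinj kinj hk hA kA hkA cardX.
pose num y := odflt ord0 [pick i | f (w i) == y].
have uwi i : adj u (w i) by rewrite uw; apply/existsP; exists i.
have numP y : adj v y -> f (w (num y)) = y.
  move=> vy; have [] := star_invP finj fim vy.
  rewrite uw => /existsP [i /eqP ->] fy; rewrite /num.
  by case: pickP => [j /eqP //|/(_ i)]; rewrite fy eqxx.
(* The identification of K_{3,3} - v with K_{2,3}; the default of [unlift] is taken only at [v]. *)
pose p (y : Kbip 3 3) : Kbip 2 3 := if adj v y then inr (num y)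
  else inl (odflt ord0 (unlift (Kbip_index v) (Kbip_index y))).
have pA y z : adj (p y) (p z) = adj y z.
  rewrite (Kbip_adj_addb v).
  by rewrite Kbip_adjE /p; case: (adj v y); case: (adj v z).
have pinj y z : y != v -> z != v -> p y = p z -> y = z.
  rewrite /p; have [vy|vy] := boolP (adj v y); have [vz|vz] := boolP (adj v z) => //.
    by move=> _ _ [yz]; rewrite -(numP y) // yz numP.
  by move=> /(Kbip_same_side vy) [i -> ->] /(Kbip_same_side vz) [j -> ->] [->].
pose g (a : star_product u v f) : X :=
  match a with inl x => h (val x) | inr y => k (p (val y)) end.
have lr x y : x != u -> adj u x && (y == f x) = adj (h x) (k (p y)).
  move=> xu; rewrite hkA // /p; have [vy|vy] := boolP (adj v y).
    apply/andP/eqP => [[ux /eqP yx]|->]; last by rewrite numP.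
    by apply: finj; rewrite ?inE // numP.
  apply/negP => /andP [ux /eqP yx]; case/negP: vy.
  by rewrite yx (star_fun_adj fim).
exists g.
  apply: inj_card_bij.
    move=> [x|y] [z|t] /=.
    - by move=> E; congr inl; apply: val_inj; apply: hinj E;
        [apply: (valP x)|apply: (valP z)].
    - by move/eqP; rewrite (negPf (hk _ _ (valP x))).
    - by move/eqP; rewrite eq_sym (negPf (hk _ _ (valP z))).
    - move=> /kinj E; congr inr; apply: val_inj; apply: pinj E;
        [apply: (valP y)|apply: (valP t)].
  (* The product has (|G| - 1) + (6 - 1) vertices, so injectivity of [g] already makes it
     bijective. *)
  apply: leq_trans cardX _.
  have cardD1 (T : finType) (t : T) : #|{: {x | x != t}}| = #|T|.-1.
    by rewrite card_sig -(cardC1 t); apply: eq_card.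
  rewrite card_sum !cardD1 [#|Kbip 3 3|]card_sum !card_ord.
  by case: #|G| => // n; rewrite addSnnS.
move=> [x|y] [z|t].
- by rewrite star_adj_ll hA ?(valP x) ?(valP z).
- by rewrite star_adj_lr lr ?(valP x).
- by rewrite star_adj_rl lr ?(valP z) // adjC.
- by rewrite star_adj_rr kA pA.
Qed.

(** * Boolean checkers for finite graphs *)

(* The library enumerations of ordinals are opaque to computation; these lists
   are not. *)
Fixpoint ord_list (n : nat) : seq 'I_n :=
  if n is k.+1 then ord0 :: [seq lift ord0 i | i <- ord_list k] else [::].

Lemma mem_ord_list n (i : 'I_n) : i \in ord_list n.
Proof.
elim: n i => [[] //|n IHn] i; rewrite inE.
by case: (unliftP ord0 i) => [j ->|->]; rewrite ?eqxx // map_f ?orbT.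
Qed.

Definition sum_list (S T : Type) (s : seq S) (t : seq T) : seq (S + T) :=
  [seq inl x | x <- s] ++ [seq inr x | x <- t].

Lemma mem_sum_list (S T : eqType) (s : seq S) (t : seq T) :
  (forall x, x \in s) -> (forall x, x \in t) -> forall x, x \in sum_list s t.
Proof. by move=> sP tP [x|x]; rewrite mem_cat map_f ?orbT. Qed.

Definition Kbip_list (m n : nat) : seq (Kbip m n) :=
  sum_list (ord_list m) (ord_list n).

Lemma mem_Kbip_list m n x : x \in Kbip_list m n.
Proof. by apply: mem_sum_list => i; apply: mem_ord_list. Qed.

Section Checkers.
Variables (G : sgraph) (s : seq G).
Hypothesis sP : forall x, x \in s.

Lemma all_listP (P : pred G) : all P s -> forall x, P x.
Proof. by move/allP => sPx x; apply: sPx. Qed.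

Lemma all2_listP (P : rel G) : all (fun x => all (P x) s) s -> forall x y, P x y.
Proof. by move=> /all_listP PP x; apply/all_listP/PP. Qed.

Hypothesis s_uniq : uniq s.

Lemma card_list (P : pred G) : #|[set x | P x]| = count P s.
Proof.
rewrite cardsE cardE -size_filter; apply: perm_size.
apply: uniq_perm; rewrite ?enum_uniq ?filter_uniq // => x.
by rewrite mem_enum mem_filter sP andbT.
Qed.

Definition cut_at_check (u : G) (m : G -> G) (c : G -> bool) : bool :=
  [&& all (fun x => (x != u) ==>
        ((m x != x) ==> adj x (m x)) && ((m x != u) ==> (m (m x) == x))) s,
      count (fun x => (x != u) && (m x == x)) s +
        defect (count (fun x => (x != u) && (m x == u)) s) <= 2,
      has (fun x => has (fun y => c x != c y) s) s
    & all (fun x => all (fun y =>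
        [&& x != u, adj x y & c x != c y] ==> (m x == y)) s) s].

Lemma cut_at_checkP u m c : cut_at_check u m c -> cut_matchable_at u.
Proof.
case/and4P => /all_listP nm card2 /hasP [a _ /hasP [b _ cab]] /all2_listP cut.
exists m, c; split.
- move=> x xu; have := nm x; rewrite xu /= => /andP [/implyP xA /implyP mK].
  by split=> // /mK /eqP.
- by rewrite /exposed /attached !card_list.
- by exists a, b.
- by move=> x y xu xy cxy; have := cut x y; rewrite xu xy cxy => /eqP.
Qed.

Definition cut_check (m : G -> G) (c : G -> bool) : bool :=
  [&& all (fun x => ((m x != x) ==> adj x (m x)) && (m (m x) == x)) s,
      count (fun x => m x == x) s <= 2,
      has (fun x => has (fun y => c x != c y) s) s
    & all (fun x => all (fun y => adj x y && (c x != c y) ==> (m x == y)) s) s].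

Lemma cut_checkP m c : cut_check m c -> cut_matchable G.
Proof.
case/and4P => /all_listP mm card2 /hasP [a _ /hasP [b _ cab]] /all2_listP cut.
exists m, c; split.
- split=> x; have /andP [xA mK] := mm x; first exact/eqP.
  exact/implyP.
- by rewrite card_list.
- by exists a, b.
- by move=> x y xy cxy; have := cut x y; rewrite xy cxy => /eqP.
Qed.

(** The vertices that [n] rounds of breadth-first search from [x] find in G - u; the check is sound
    for every [n]. *)
Definition reach (u x : G) (n : nat) : seq G :=
  iter n (fun r =>
    undup (r ++ flatten [seq [seq y <- s | (y != u) && adj z y] | z <- r])) [:: x].

Definition connected_check (n : nat) : bool :=
  all (fun u => all (fun x => (x != u) ==>
    all (fun y => (y != u) ==> (y \in reach u x n)) s) s) s.

Lemma connected_checkP n : connected_check n -> forall u : G, connected_without u.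
Proof.
move/all2_listP => chk u c cA x y xu yu.
have yr : y \in reach u x n.
  by have := chk u x; rewrite xu => /all_listP /(_ y); rewrite yu.
(* The induction also carries [y != u], which the edge condition on [c] requires of both ends. *)
have : (y != u) && (c x == c y); last by case/andP => _ /eqP.
elim: n y {yu chk} yr => [|n IHn] y.
  by rewrite inE => /eqP ->; rewrite xu eqxx.
rewrite /reach iterS -/(reach u x n) mem_undup mem_cat => /orP [/IHn //|].
case/flattenP => _ /mapP [z /IHn /andP [zu /eqP ->] ->].
by rewrite mem_filter => /andP [/andP [yu zy] _]; rewrite yu (cA z y) ?eqxx.
Qed.

End Checkers.

(** * The two blocks: K_{3,3} and the Heawood graph *)

Lemma Kbip33_connected_without (u : Kbip 3 3) : connected_without u.
Proof.
apply: (@connected_checkP _ (Kbip_list 3 3) (@mem_Kbip_list 3 3) 3).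
by vm_compute.
Qed.

(** Pairing the sides through the transposition of [a] and [b] is a perfect matching containing the
    edge from [a] to [b]. *)
Lemma Kbip_edge_matchable n : edge_matchable (Kbip n n).
Proof.
have pm (a b : 'I_n) : perfect_map (fun x : Kbip n n => match x with
    | inl i => inr (tperm a b i) | inr i => inl (tperm a b i) end : Kbip n n).
  by split; case=> i; rewrite ?tpermK ?Kbip_adjE.
move=> x y; rewrite Kbip_adjE; case: x y => a [b|b] // _;
  by eexists; [apply: (pm a b) | rewrite /= tpermL].
Qed.

Definition heawood_list : seq heawood := sum_list (ord_list 7) (ord_list 7).

Lemma mem_heawood_list x : x \in heawood_list.
Proof. by apply: mem_sum_list => i; apply: mem_ord_list. Qed.

Lemma heawood_connected_without (u : heawood) : connected_without u.
Proof.
apply: (@connected_checkP _ heawood_list mem_heawood_list 4).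
by vm_compute.
Qed.

(** Point p lies on line p - d for d in {0, 1, 3}: the edges of a fixed difference d form a perfect
    matching, and these three matchings cover all edges. *)
Definition heawood_shift (d : nat) (x : heawood) : heawood :=
  match x with inl p => inr (inZp (p + (7 - d))) | inr l => inl (inZp (l + d)) end.

Lemma heawood_edge_matchable : edge_matchable heawood.
Proof.
have pm d : d \in [:: 0; 1; 3] -> perfect_map (heawood_shift d).
  have chk : all (fun d => all (fun x =>
     (heawood_shift d (heawood_shift d x) == x) && adj x (heawood_shift d x))
     heawood_list) [:: 0; 1; 3] by vm_compute.
  move=> /(allP chk) /(all_listP mem_heawood_list) E.
  by split=> x; have /andP [/eqP] := E x.
have chk : all (fun x => all (fun y => adj x y ==>
    has (fun d => heawood_shift d x == y) [:: 0; 1; 3]) heawood_list) heawood_list.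
  by vm_compute.
move=> x y xy; have := all2_listP mem_heawood_list chk x y.
by rewrite xy => /hasP [d /pm pmd /eqP xE]; exists (heawood_shift d).
Qed.

(* The cut is the 6-cycle on the non-collinear points 0, 1, 2 and the lines
   0, 1, 6 joining them; its six outgoing edges miss only point 5 and line 3. *)
Lemma heawood_cut_matchable : cut_matchable heawood.
Proof.
(* Entry 5 of the first list and entry 3 of the second are placeholders for the exposed vertices. *)
pose m (x : heawood) : heawood := match x with
  | inl p => if val p == 5 then x
             else inr (inZp (nth 0 [:: 4; 5; 2; 0; 1; 0; 6] p))
  | inr l => if val l == 3 then x
             else inl (inZp (nth 0 [:: 3; 4; 2; 0; 0; 1; 6] l))
  end.
pose c (x : heawood) := match x with
  | inl p => val p \in [:: 0; 1; 2] | inr l => val l \in [:: 0; 1; 6] end.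
apply: (@cut_checkP _ heawood_list mem_heawood_list _ m c); by vm_compute.
Qed.

(** * Expanding a vertex of an exceptional graph by K_{3,3} *)

Definition exceptional (G : sgraph) : Prop :=
  [\/ isomorphic G Fbar0, isomorphic G Fbar1, isomorphic G Fbar2
    | isomorphic G Fbar3].

Definition K33_expandable (G : sgraph) (u : G) : Prop :=
  forall (v : Kbip 3 3) (f : G -> Kbip 3 3),
    {in neighbours u &, injective f} -> f @: neighbours u = neighbours v ->
  cut_matchable (star_product u v f) \/ exceptional (star_product u v f).

Lemma exceptional_iso (G H : sgraph) :
  isomorphic G H -> exceptional H -> exceptional G.
Proof.
move=> iGH [] iH; [constructor 1|constructor 2|constructor 3|constructor 4];
  exact: isomorphic_trans iH.
Qed.

Lemma K33_expandable_cut (G : sgraph) (u : G) :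
  cut_matchable_at u -> K33_expandable u.
Proof.
move=> cu v f finj fim; left; apply: star_cut_matchable => //.
  pose y : Kbip 3 3 := if v is inl _ then inr ord0 else inl ord0.
  have : adj v y by rewrite Kbip_adjE /y; case: (v).
  by case/(star_invP finj fim) => ux _; exists (star_inv u f y).
exact: Kbip_edge_matchable.
Qed.

(** Applied to automorphisms, this leaves one vertex per orbit to treat; applied to isomorphisms, it
    passes from the concrete exceptional graphs to all their copies. *)
Lemma K33_expandable_iso (G G' : sgraph) (u : G) (h : G -> G') :
    bijective h -> (forall x y, adj (h x) (h y) = adj x y) ->
  K33_expandable (h u) -> K33_expandable u.
Proof.
move=> [k hK kK] hA ex v f finj fim.
have N : neighbours (h u) = h @: neighbours u.
  apply/setP => x; rewrite -[x]kK (mem_imset _ _ (can_inj hK)).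
  by rewrite !inE hA.
have iso := star_iso_l u v f hK kK hA.
have [x y||cut|exc] := ex v (f \o k).
- rewrite N => /imsetP [a aN ->] /imsetP [b bN ->] /=.
  by rewrite !hK => /finj ->.
- rewrite N -imset_comp -fim; apply: eq_imset => x /=; by rewrite hK.
- by left; apply: cut_matchable_iso iso cut.
- by right; apply: exceptional_iso iso exc.
Qed.

Definition sum_swap (S T : Type) (x : S + T) : T + S :=
  match x with inl y => inr y | inr y => inl y end.

Lemma sum_swapK (S T : Type) : cancel (@sum_swap S T) (@sum_swap T S).
Proof. by case. Qed.

Lemma sum_swap_bij (T : Type) : bijective (@sum_swap T T).
Proof. by exists (@sum_swap T T); apply: sum_swapK. Qed.

Lemma card_Kbip m n : #|Kbip m n| = m + n.
Proof. by rewrite card_sum !card_ord. Qed.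

Lemma mkgraph_adjE (T : finType) (e : rel T) (x y : mkgraph e) :
  irreflexive e -> adj x y = e x y || e y x.
Proof.
move=> eirr; rewrite -[LHS]/((x != y) && (e x y || e y x)).
by have [->|//] := eqVneq x y; rewrite eirr.
Qed.

Lemma Fbar1_adjE (x y : Fbar1) : adj x y = match x, y with
  | inl x, inl y | inr x, inr y => adj x y
  | inl (inr i), inr (inr j) | inr (inr i), inl (inr j) => i == j
  | _, _ => false
  end.
Proof.
rewrite mkgraph_adjE; last by case=> -[] z; rewrite /Fbar1_rel adj_irr.
by case: x y => [[a|i]|[a|i]] [[b|j]|[b|j]];
  rewrite /Fbar1_rel ?Kbip_adjE ?orbF //= eq_sym.
Qed.

(** Deleting a vertex of K_{3,3} on either side of the product leaves two copies of K_{2,3} joined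
    by a matching, which is [Fbar1]. *)
Lemma Fbar0_expandable (u : Fbar0) : K33_expandable u.
Proof.
have left_case (a : 'I_3) : K33_expandable (inl a : Fbar0).
  move=> v f finj fim; right; constructor 2.
  apply: (@star_K33_iso _ Fbar1 _ _ _
    (fun x : Fbar0 => inl (match x with
       | inl b => inl (odflt ord0 (unlift a b)) | inr i => inr i end))
    inr (fun i => inr i)) => //.
  - move=> x; rewrite Kbip_adjE; case: x => b.
      by apply/esym/negbTE/existsP => -[].
    by apply/esym/existsP; exists b.
  - move=> [b|i] [b'|i'] //=; rewrite !inE; last by move=> _ _ [->].
    move=> ba b'a [].
    case: (unliftP a b) ba => [j ->|->]; last by rewrite eqxx.
    case: (unliftP a b') b'a => [j' ->|->]; last by rewrite eqxx.
    by move=> _ _ /= ->.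
  - by move=> x y [].
  - by move=> [?|?] [?|?] _ _; rewrite Fbar1_adjE !Kbip_adjE.
  - by move=> [?|?] [?|?]; rewrite Fbar1_adjE !Kbip_adjE.
  - by move=> [?|?] [?|?] _; rewrite Fbar1_adjE.
  - by rewrite card_sum !card_Kbip.
case: u => a //.
apply: (@K33_expandable_iso Fbar0 Fbar0 (inr a) (@sum_swap _ _)) => //.
  exact: sum_swap_bij.
  by move=> x y; rewrite !Kbip_adjE; case: x y => ? [].
exact: left_case.
Qed.

(** * Explicit cuts at vertices of the exceptional graphs *)

(* The matching of K_{2,3} that exposes only the degree-2 vertex i. *)
Definition K23_match (i : 'I_3) (x : Kbip 2 3) : Kbip 2 3 :=
  match x with
  | inl a => inr (inZp (i + a.+1))
  | inr j => if j == i then x else inl (inZp ((j + 3 - i) %% 3).-1)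
  end.

Definition Fbar1_list : seq Fbar1 := sum_list (Kbip_list 2 3) (Kbip_list 2 3).
Definition Fbar2_list : seq Fbar2 :=
  sum_list (Kbip_list 1 3) (sum_list (Kbip_list 2 3) (Kbip_list 2 3)).
Definition Fbar3_list : seq Fbar3 :=
  sum_list (ord_list 3) [seq (k, x) | k <- ord_list 3, x <- Kbip_list 2 3].

Lemma mem_Fbar1_list x : x \in Fbar1_list.
Proof. by apply: mem_sum_list x; apply: mem_Kbip_list. Qed.

Lemma mem_Fbar2_list x : x \in Fbar2_list.
Proof. by apply: mem_sum_list x; last apply: mem_sum_list; apply: mem_Kbip_list. Qed.

Lemma mem_Fbar3_list x : x \in Fbar3_list.
Proof.
apply: mem_sum_list x; first exact: mem_ord_list.
case=> k x; apply/allpairsP; exists (k, x).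
by rewrite mem_ord_list mem_Kbip_list.
Qed.

(* The cut surrounds the 4-cycle on the other four vertices of the K_{2,3} that
   contains u. *)
Lemma Fbar1_cut_leaf (i : 'I_3) : cut_matchable_at (inl (inr i) : Fbar1).
Proof.
pose u i : Fbar1 := inl (inr i).
pose m i (x : Fbar1) : Fbar1 := match x with
  | inl (inl _) => u i
  | inl (inr j) => inr (inr j)
  | inr (inl a) => if a == ord0 then inr (inr i) else x
  | inr (inr j) => if j == i then inr (inl ord0) else inl (inr j)
  end.
pose c i (x : Fbar1) := match x with
  | inl y => y != inr i | inr _ => false end.
have chk : all (fun i => cut_at_check Fbar1_list (u i) (m i) (c i)) (ord_list 3).
  by vm_compute.
by have /(cut_at_checkP mem_Fbar1_list) := allP chk i (mem_ord_list i); apply.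
Qed.

(* As for Fbar1: a 4-cycle in the K_{2,3} of u. *)
Lemma Fbar2_cut_leaf (i : 'I_3) : cut_matchable_at (inr (inl (inr i)) : Fbar2).
Proof.
pose u i : Fbar2 := inr (inl (inr i)).
pose m i (x : Fbar2) : Fbar2 := match x with
  | inl (inl _) => inl (inr i)
  | inl (inr j) => if j == i then inl (inl ord0) else inr (inl (inr j))
  | inr (inl (inl _)) => u i
  | inr (inl (inr j)) => inl (inr j)
  | inr (inr y) => inr (inr (K23_match i y))
  end.
pose c i (x : Fbar2) := if x is inr (inl y) then y != inr i else false.
have chk : all (fun i => cut_at_check Fbar2_list (u i) (m i) (c i)) (ord_list 3).
  by vm_compute.
by have /(cut_at_checkP mem_Fbar2_list) := allP chk i (mem_ord_list i); apply.
Qed.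

(* The cut surrounds the 4-cycle d, c_j, X, c_k, with the first K_{2,3} contracted
   to a vertex X. *)
Lemma Fbar2_cut_star (i : 'I_3) : cut_matchable_at (inl (inr i) : Fbar2).
Proof.
pose u i : Fbar2 := inl (inr i).
pose m i (x : Fbar2) : Fbar2 := match x with
  | inl (inl _) => u i
  | inl (inr j) => inr (inr (inr j))
  | inr (inl y) => if y == inr i then u i else inr (inl (K23_match i y))
  | inr (inr (inl a)) => if a == ord0 then inr (inr (inr i)) else x
  | inr (inr (inr j)) => if j == i then inr (inr (inl ord0)) else inl (inr j)
  end.
pose c i (x : Fbar2) := match x with
  | inl y => y != inr i | inr (inl _) => true | inr (inr _) => false end.
have chk : all (fun i => cut_at_check Fbar2_list (u i) (m i) (c i)) (ord_list 3).
  by vm_compute.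
by have /(cut_at_checkP mem_Fbar2_list) := allP chk i (mem_ord_list i); apply.
Qed.

(* The cut surrounds the 6-cycle x_1, q, x_2, c_2, d, c_1, where q is the other
   centre of the K_{2,3} of u. *)
Lemma Fbar2_cut_hub (a : 'I_2) : cut_matchable_at (inr (inl (inl a)) : Fbar2).
Proof.
pose u a : Fbar2 := inr (inl (inl a)).
pose e : 'I_3 := ord_max.
pose m a (x : Fbar2) : Fbar2 := match x with
  | inl (inl _) => inl (inr e)
  | inl (inr j) => if j == e then inl (inl ord0) else inr (inr (inr j))
  | inr (inl (inl _)) => inr (inl (inr e))
  | inr (inl (inr j)) => if j == e then u (rev_ord a) else u a
  | inr (inr (inl b)) => if b == ord0 then inr (inr (inr e)) else x
  | inr (inr (inr j)) => if j == e then inr (inr (inl ord0)) else inl (inr j)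
  end.
pose c a (x : Fbar2) := match x with
  | inl y => y != inr e
  | inr (inl y) => (y != inl a) && (y != inr e)
  | inr (inr _) => false end.
have chk : all (fun a => cut_at_check Fbar2_list (u a) (m a) (c a)) (ord_list 2).
  by vm_compute.
by have /(cut_at_checkP mem_Fbar2_list) := allP chk a (mem_ord_list a); apply.
Qed.

(* As for Fbar1: a 4-cycle in the K_{2,3} of u. *)
Lemma Fbar3_cut_leaf (i : 'I_3) : cut_matchable_at (inr (ord0, inr i) : Fbar3).
Proof.
pose u i : Fbar3 := inr (ord0, inr i).
pose m i (x : Fbar3) : Fbar3 := match x with
  | inl j => if j == i then inr (inZp 1, inr i) else inr (ord0, inr j)
  | inr (k, y) =>
    if val k == 0 then if y is inr j then inl j else u i
    else if (val k == 1) && (y == inr i) then inl i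
    else inr (k, K23_match i y)
  end.
pose c i (x : Fbar3) :=
  if x is inr (k, y) then (val k == 0) && (y != inr i) else false.
have chk : all (fun i => cut_at_check Fbar3_list (u i) (m i) (c i)) (ord_list 3).
  by vm_compute.
by have /(cut_at_checkP mem_Fbar3_list) := allP chk i (mem_ord_list i); apply.
Qed.

(* The cut surrounds the 4-cycle z_j, X, z_k, Y, with the first two copies of
   K_{2,3} contracted to vertices X and Y. *)
Lemma Fbar3_cut_joint (i : 'I_3) : cut_matchable_at (inl i : Fbar3).
Proof.
pose u i : Fbar3 := inl i.
pose m i (x : Fbar3) : Fbar3 := match x with
  | inl j => inr (ord_max, inr j)
  | inr (k, y) =>
    if val k < 2 then if y == inr i then u i else inr (k, K23_match i y)
    else match y with
    | inl a => if a == ord0 then inr (k, inr i) else x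
    | inr j => if j == i then inr (k, inl ord0) else inl j
    end
  end.
pose c i (x : Fbar3) := match x with
  | inl j => j != i | inr (k, _) => val k < 2 end.
have chk : all (fun i => cut_at_check Fbar3_list (u i) (m i) (c i)) (ord_list 3).
  by vm_compute.
by have /(cut_at_checkP mem_Fbar3_list) := allP chk i (mem_ord_list i); apply.
Qed.

(* As for Fbar2, with d replaced by the second copy of K_{2,3}. *)
Lemma Fbar3_cut_hub (a : 'I_2) : cut_matchable_at (inr (ord0, inl a) : Fbar3).
Proof.
pose u a : Fbar3 := inr (ord0, inl a).
pose e : 'I_3 := ord_max.
pose m a (x : Fbar3) : Fbar3 := match x with
  | inl j => if j == e then inr (inZp 1, inr e) else inr (ord_max, inr j)
  | inr (k, y) =>
    if val k == 0 then match y with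
      | inl _ => inr (k, inr e)
      | inr j => if j == e then u (rev_ord a) else u a end
    else if val k == 1 then if y == inr e then inl e else inr (k, K23_match e y)
    else match y with
      | inl b => if b == ord0 then inr (k, inr e) else x
      | inr j => if j == e then inr (k, inl ord0) else inl j end
  end.
pose c a (x : Fbar3) := match x with
  | inl j => j != e
  | inr (k, y) =>
    if val k == 0 then (y != inl a) && (y != inr e) else val k == 1
  end.
have chk : all (fun a => cut_at_check Fbar3_list (u a) (m a) (c a)) (ord_list 2).
  by vm_compute.
by have /(cut_at_checkP mem_Fbar3_list) := allP chk a (mem_ord_list a); apply.
Qed.

(** * Expansions of [Fbar1], [Fbar2] and [Fbar3] *)

Lemma Fbar2_adjE (x y : Fbar2) : adj x y = match x, y with
  | inl x, inl y => adj x y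
  | inr (inl x), inr (inl y) | inr (inr x), inr (inr y) => adj x y
  | inl (inr i), inr (inl (inr j)) | inl (inr i), inr (inr (inr j))
  | inr (inl (inr i)), inl (inr j) | inr (inr (inr i)), inl (inr j) => i == j
  | _, _ => false
  end.
Proof.
rewrite mkgraph_adjE; last first.
  by case=> [[]|[[]|[]]] z; rewrite /Fbar2_rel adj_irr.
by case: x y => [[a|i]|[[a|i]|[a|i]]] [[b|j]|[[b|j]|[b|j]]];
  rewrite /Fbar2_rel ?Kbip_adjE ?orbF //= eq_sym.
Qed.

Lemma Fbar3_adjE (x y : Fbar3) : adj x y = match x, y with
  | inr (k, x), inr (l, y) => (k == l) && adj x y
  | inl i, inr (_, inr j) | inr (_, inr j), inl i => i == j
  | _, _ => false
  end.
Proof.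
rewrite mkgraph_adjE; last first.
  by case=> [//|[k [] z]]; rewrite /Fbar3_rel adj_irr andbF.
case: x y => [i|[k [a|i]]] [j|[l [b|j]]];
  by rewrite /Fbar3_rel ?Kbip_adjE ?orbF //= ?andbF // [l == k]eq_sym orbb.
Qed.

Lemma ord2_unique (a b c : 'I_2) : b != a -> c != a -> b = c.
Proof.
by case: a b c => [[|[|//]] ?] [[|[|//]] ?] [[|[|//]] ?] // _ _; apply: val_inj.
Qed.

(** Degree-2 vertices of a K_{2,3} admit a cut. Deleting a centre turns its K_{2,3} into a star
    around the other centre, whose leaves now meet two copies of K_{2,3}: this is [Fbar2]. *)
Lemma Fbar1_expandable (u : Fbar1) : K33_expandable u.
Proof.
have left_case (x : Kbip 2 3) : K33_expandable (inl x : Fbar1).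
  case: x => [a|i]; last exact/K33_expandable_cut/Fbar1_cut_leaf.
  move=> v f finj fim; right; constructor 3.
  apply: (@star_K33_iso _ Fbar2 _ _ _
    (* Both centres go to the star centre, but one of them is the deleted [u]. *)
    (fun x : Fbar1 => match x with
       | inl (inl _) => inl (inl ord0) | inl (inr i) => inl (inr i)
       | inr y => inr (inl y) end)
    (fun y => inr (inr y)) (fun i => inl (inr i))) => //.
  - move=> x; rewrite Fbar1_adjE; case: x => [[b|j]|x].
    + by rewrite Kbip_adjE; apply/esym/negbTE/existsP => -[].
    + by rewrite Kbip_adjE; apply/esym/existsP; exists j.
    + by apply/esym/negbTE/existsP => -[].
  - move=> [[b|j]|y] [[b'|j']|y'] //=; rewrite !inE => ba b'a.
    + by rewrite (ord2_unique ba b'a).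
    + by case=> ->.
    + by case=> ->.
  - by move=> x y [].
  - by case=> [[?|?]|?].
  - by move=> [[?|?]|[?|?]] [[?|?]|[?|?]] _ _;
      rewrite Fbar1_adjE Fbar2_adjE ?Kbip_adjE.
  - by move=> [?|?] [?|?]; rewrite Fbar2_adjE !Kbip_adjE.
  - by move=> [[?|?]|[?|?]] [?|?] _; rewrite Fbar2_adjE.
  - by rewrite !card_sum !card_ord.
case: u => x; first exact: left_case.
apply: (@K33_expandable_iso Fbar1 Fbar1 (inr x) (@sum_swap _ _)).
- exact: sum_swap_bij.
- by move=> [[?|?]|[?|?]] [[?|?]|[?|?]]; rewrite !Fbar1_adjE.
- exact: left_case.
Qed.

(** Only the star centre lacks a cut; replacing it by a third K_{2,3} gives [Fbar3], with the star
    leaves as the vertices z_i. *)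
Lemma Fbar2_expandable (u : Fbar2) : K33_expandable u.
Proof.
have left_case (x : Kbip 2 3) : K33_expandable (inr (inl x) : Fbar2).
  apply: K33_expandable_cut; case: x => [a|i].
    exact: Fbar2_cut_hub.
  exact: Fbar2_cut_leaf.
case: u => [[a|i]|[x|x]].
- move=> v f finj fim; right; constructor 4.
  apply: (@star_K33_iso _ Fbar3 _ _ _
    (* The value at the star centre is a dummy, since that vertex is deleted. *)
    (fun x : Fbar2 => match x with
       | inl (inl _) => inl ord0 | inl (inr i) => inl i
       | inr (inl y) => inr (ord0, y) | inr (inr y) => inr (inZp 1, y) end)
    (fun y => inr (ord_max, y)) (fun i => inl (inr i))) => //.
  + move=> x; rewrite Fbar2_adjE; case: x => [[b|j]|[x|x]].
    * by rewrite Kbip_adjE; apply/esym/negbTE/existsP => -[].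
    * by rewrite Kbip_adjE; apply/esym/existsP; exists j.
    * by apply/esym/negbTE/existsP => -[].
    * by apply/esym/negbTE/existsP => -[].
  + move=> [[b|j]|[y|y]] [[b'|j']|[y'|y']] //=; rewrite !inE ?ord1 ?eqxx //.
    * by move=> _ _ [->].
    * by move=> _ _ [->].
    * by move=> _ _ [->].
  + by move=> x y [].
  + by case=> [[?|?]|[?|?]].
  + move=> [[b|?]|[[?|?]|[?|?]]] [[b'|?]|[[?|?]|[?|?]]];
      rewrite ?[b]ord1 ?[b']ord1 ?[a]ord1 ?eqxx // => _ _;
      by rewrite Fbar2_adjE Fbar3_adjE ?Kbip_adjE.
  + by move=> [?|?] [?|?]; rewrite Fbar3_adjE !Kbip_adjE.
  + by move=> [[b|?]|[[?|?]|[?|?]]] [?|?];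
      rewrite ?[b]ord1 ?[a]ord1 ?eqxx // Fbar3_adjE.
  + by rewrite card_sum card_prod !card_sum !card_ord.
- exact/K33_expandable_cut/Fbar2_cut_star.
- exact: left_case.
apply: (@K33_expandable_iso Fbar2 Fbar2 (inr (inr x)) (fun y =>
  match y with inl y => inl y | inr y => inr (sum_swap y) end)).
- by exists (fun y => match y with inl y => inl y | inr y => inr (sum_swap y) end);
    case=> // -[].
- by move=> [[?|?]|[[?|?]|[?|?]]] [[?|?]|[[?|?]|[?|?]]]; rewrite !Fbar2_adjE.
- exact: left_case.
Qed.

(** Every vertex admits a cut, so the list of exceptions ends here. A transposition of the three
    copies of K_{2,3} brings the vertex into copy 0. *)
Lemma Fbar3_expandable (u : Fbar3) : K33_expandable u.
Proof.
case: u => [i|[k x]]; first exact/K33_expandable_cut/Fbar3_cut_joint.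
pose h (y : Fbar3) : Fbar3 :=
  match y with inl i => inl i | inr (l, y) => inr (tperm k ord0 l, y) end.
apply: (@K33_expandable_iso Fbar3 Fbar3 (inr (k, x)) h).
- by exists h; case=> [//|[l y]]; rewrite /h tpermK.
- move=> [i|[l [a|i]]] [j|[l' [b|j]]]; rewrite !Fbar3_adjE //=;
    by rewrite (inj_eq perm_inj).
- rewrite /h tpermL; apply: K33_expandable_cut; case: x => [a|i].
    exact: Fbar3_cut_hub.
  exact: Fbar3_cut_leaf.
Qed.

(** * Induction over the class and the bound *)

(** Edge matchability of G is carried along so that a cut of a Heawood factor can be completed
    inside G; connectivity makes a nonconstant colouring yield a separating matching. *)
Lemma classF_invariant (G : sgraph) : classF G ->
  [/\ edge_matchable G, connected G & cut_matchable G \/ exceptional G].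
Proof.
have without (H : sgraph) (v : H) : is_block H -> connected_without v.
  by case=> E; subst H; [apply: heawood_connected_without|
    apply: Kbip33_connected_without].
have em H : is_block H -> edge_matchable H.
  by case=> ->; [apply: heawood_edge_matchable | apply: Kbip_edge_matchable].
elim=> {G} [G H bH iso | G H G' u v _ [emG cG goodG] bH [cub _ [f [finj fim iso]]]].
  split; first exact: edge_matchable_iso iso (em H bH).
    apply: connected_iso iso _; case: bH => ->.
      apply: (@connected_of_without _ (inl ord0 : heawood));
        last exact: heawood_connected_without.
      by exists (inr ord0).
    apply: (@connected_of_without _ (inl ord0 : Kbip 3 3));
      last exact: Kbip33_connected_without.
    by exists (inr ord0).
  case: bH => E; subst H; last by right; constructor 1.
  left; exact: cut_matchable_iso iso heawood_cut_matchable.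
have [t ut] : exists t, adj u t.
  have : 0 < #|neighbours u| by rewrite cub.
  by case/card_gt0P => t; rewrite inE; exists t.
have ut' : exists t, adj u t by exists t.
have emH := em H bH.
split.
- exact: edge_matchable_iso iso (star_edge_matchable finj fim emG emH).
- exact: connected_iso iso (star_connected fim ut' cG (without _ v bH)).
suff [cut|exc] : cut_matchable (star_product u v f) \/
    exceptional (star_product u v f).
- by left; apply: cut_matchable_iso iso cut.
- by right; apply: exceptional_iso iso exc.
case: goodG => [cut|exc].
  left; apply: star_cut_matchable => //; exact: cut_matchable_at_of.
(* For a Heawood factor the roles are exchanged and its own cut is used; for K_{3,3} the exceptional
   graphs are expanded. *)
case: bH => E; subst H.
  left; apply: cut_matchable_iso (star_swap finj fim) _.
  apply: star_cut_matchable => //.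
  - exact: star_inv_inj.
  - exact: star_inv_im.
  - by exists (f t); apply: (star_fun_adj fim).
  - exact/cut_matchable_at_of/heawood_cut_matchable.
suff : K33_expandable u by apply.
case: exc => -[h hB hA]; apply: (K33_expandable_iso hB hA).
- exact: Fbar0_expandable.
- exact: Fbar1_expandable.
- exact: Fbar2_expandable.
- exact: Fbar3_expandable.
Qed.

Theorem theorem5 (G : sgraph) :
  classF G ->
  ~ isomorphic G Fbar0 -> ~ isomorphic G Fbar1 ->
  ~ isomorphic G Fbar2 -> ~ isomorphic G Fbar3 ->
  (#|G|%:R / 2%:R - 1 <= (mms G)%:R :> rat)%R.
Proof.
case/classF_invariant => _ cG [cut | [] //] _ _ _ _.
have /(mms_ge cG) le := cut.
(* Clearing the denominator turns the goal into the natural number inequality of [mms_ge]. *)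
rewrite Num.Theory.lerBlDr Num.Theory.ler_pdivrMr //.
rewrite GRing.Theory.mulrDl GRing.Theory.mul1r -GRing.Theory.natrM.
rewrite -GRing.Theory.natrD Num.Theory.ler_nat.
exact: le.
Qed.
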